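(* Let $P(x)=R(x)-q=0$ be a real quadratic, cubic or quartic polynomial equation in $x$, with $R(0)=0$ and $q\in\mathbb{R}$. Let $x(q)$ be one of the roots of this equation, defined in a neighborhood of $0$, that tends to $0$ as $q$ tends to $0$. Then $x(q)$ satisfies, respectively, a linear, Riccati or Abel ODE whose coefficients are rational functions in $q$.
   Context: $R\in\mathbb{R}[x]$ is a polynomial of degree $2$, $3$ or $4$, respectively, not depending on $q$. For an integer $m>0$, a generalized Abel ODE of degree $m$ is a non-autonomous first order real ODE of the form $x'=a_m(q)x^m+\cdots+a_1(q)x+a_0(q)$ (the leading coefficient is not required to be nonzero), $'=\mathrm{d}/\mathrm{d}q$; for $m=1,2,3$ it is called a linear, Riccati, Abel ODE, respectively. The root $x(q)$ is a continuous branch of solutions, i.e. a continuous (real- or complex-valued) function of the real variable $q$ near $0$ with $R(x(q))=q$. That $x(q)$ satisfies the ODE means that the equation holds at each $q$ of its domain at which $x$ is differentiable and the coefficients have no pole (a pole at $q=0$ may occur). *)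

(* Defs.v *)
From HB Require Import structures.
From mathcomp Require Import all_boot all_order all_algebra.
From mathcomp Require Import all_classical all_reals all_analysis.
From mathcomp.real_closed Require Import complex.
Set Implicit Arguments.
Unset Strict Implicit.
Unset Printing Implicit Defensive.
Import Order.TTheory GRing.Theory Num.Theory.
Import numFieldNormedType.Exports.
Local Open Scope classical_set_scope.
Local Open Scope ring_scope.
Local Open Scope complex_scope.

(* The topology and norm that [R[i]] carries as a numeric field, declared on
   [R[i]] as the library does for the abstract numeric fields. *)
HB.instance Definition _ (R : realType) :=
  PseudoPointedMetric.copy R[i] (R[i])^o.
HB.instance Definition _ (R : realType) := GRing.ComAlgebra.copy R[i] (R[i])^o.
HB.instance Definition _ (R : realType) := Vector.copy R[i] (R[i])^o.
HB.instance Definition _ (R : realType) := NormedModule.copy R[i] (R[i])^o.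

(* [real_is_derive x q l]: the complex-valued function [x] of a real variable
   is differentiable at [q] with derivative [l].  The library's [is_derive]
   does not apply, because [R[i]] is normed over itself and not over [R]. *)
Definition real_is_derive (R : realType) (x : R -> R[i]) (q : R) (l : R[i]) :
    Prop :=
  (h%:C)^-1 * (x (q + h) - x q) @[h --> (0 : R)^'] --> l.

(* [ratfun_value f q v]: the rational function [f] has no pole at [q] and takes
   the value [v] there.  Any representation of [f] whose denominator does not
   vanish at [q] is allowed, so removable singularities are not poles. *)
Definition ratfun_value (R : realType) (f : {fraction {poly R}}) (q v : R) :
    Prop :=
  exists n d : {poly R},
    [/\ f = tofrac n / tofrac d, d.[q] != 0 & v = n.[q] / d.[q]].

(* [x' = a_m(q) x^m + ... + a_1(q) x + a_0(q)] at each point of [U] where [x]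
   is differentiable and no coefficient has a pole. *)
Definition solves_abel_ode (R : realType) (m : nat)
    (a : 'I_m.+1 -> {fraction {poly R}}) (U : set R) (x : R -> R[i]) : Prop :=
  forall (q : R) (l : R[i]) (v : 'I_m.+1 -> R),
    U q -> real_is_derive x q l -> (forall i, ratfun_value (a i) q (v i)) ->
    l = \sum_(i < m.+1) (v i)%:C * x q ^+ i.

(* [x] satisfies on [U] a generalized Abel ODE of degree [m] whose
   coefficients are rational functions of the independent variable. *)
Definition satisfies_rational_ode (R : realType) (m : nat) (U : set R)
    (x : R -> R[i]) : Prop :=
  exists a : 'I_m.+1 -> {fraction {poly R}}, solves_abel_ode a U x.

Definition satisfies_linear_ode (R : realType) := @satisfies_rational_ode R 1.
Definition satisfies_riccati_ode (R : realType) := @satisfies_rational_ode R 2.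
Definition satisfies_abel_ode (R : realType) := @satisfies_rational_ode R 3.

(* [x] is a branch on [U] of the roots of [P(x) = p(x) - q]. *)
Definition root_branch (R : realType) (p : {poly R}) (U : set R)
    (x : R -> R[i]) : Prop :=
  forall q : R, U q ->
    {for q, continuous x} /\ root (map_poly (real_complex R) (p - q%:P)) (x q).

(* Main.v *)
(** Differentiating [p(x(q)) = q] gives [x' = 1 / p'(x)].  Since [p(X) - q] is
    prime to [p'(X)] over [R(q)], the resultant of the two in [X] is a nonzero
    [D(q)] and Bezout's identity inverts [p'(X)] modulo [p(X) - q] as
    [v(X, q) / D(q)] with [v] of degree less than [deg p] in [X]; this is the
    right-hand side of the ODE.  At a zero of [D] where the reduced coefficients
    [v_i / D] have no pole the ODE still holds, because substituting [q := p(X)]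
    turns the relation into an identity of polynomials in [X], from which
    [D(p(X))] can be cancelled. *)

Require Import Defs.
From mathcomp Require Import all_boot all_order all_algebra.
From mathcomp Require Import all_classical all_reals all_analysis.
From mathcomp.real_closed Require Import complex polyorder.
Import Order.TTheory GRing.Theory Num.Theory.
Import numFieldNormedType.Exports.
Local Open Scope classical_set_scope.
Local Open Scope ring_scope.
Local Open Scope complex_scope.

(** A vanishing resultant would give [u * (p(X) - Y) = v * q(X)] with [u] nonzero and of smaller
    degree in [X] than [q]. This is impossible because [p(X) - Y] is linear in [Y] with leading
    coefficient [-1]. *)
Lemma resultant_sub_XC_neq0 (F : fieldType) (p q : {poly F}) :
  q != 0 -> resultant (p^:P - 'X%:P) q^:P != 0.
Proof.
move=> q0; apply/negP; rewrite resultant_eq0 => gcd_gt1.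
have q'0 : q^:P != 0 by rewrite map_polyC_eq0.
have swapP : swapXY (p^:P - 'X%:P) = - ('X - p%:P).
  by rewrite raddfB /= swapXY_map_polyC swapXY_Y opprB.
have P0 : p^:P - 'X%:P != 0 by rewrite -swapXY_eq0 swapP oppr_eq0 polyXsubC_eq0.
have : ~~ Pdiv.Idomain.coprimep (p^:P - 'X%:P) q^:P.
  by rewrite Pdiv.Idomain.coprimep_def neq_ltn gcd_gt1 orbT.
move=> /(Pdiv.Idomain.Bezout_coprimepPn P0 q'0)[[u v] /= /andP[]].
rewrite size_map_polyC => /andP[u0 ltuq] _.
move=> /(congr1 (fun r => lead_coef (swapXY r))).
rewrite !rmorphM /= swapP swapXY_map_polyC mulrN lead_coefN !lead_coefM.
rewrite lead_coefXsubC mulr1 lead_coefC => lead_u.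
(* In the parameter [Y], the leading coefficient of [u * (p(X) - Y)] is
   that of [- u], and that of [v * q(X)] is a multiple of [q(X)]. *)
have /dvdp_leq : q %| lead_coef (swapXY u).
  by rewrite -dvdpNr lead_u dvdp_mull.
rewrite lead_coef_eq0 swapXY_eq0 -size_poly_gt0 => /(_ u0); apply/negP.
rewrite -ltnNge; apply: leq_ltn_trans ltuq.
by rewrite -[in leqRHS](swapXYK u) -sizeYE max_size_coefXY.
Qed.

Lemma comp_inverse_relation (F : fieldType) (m : nat) (p q : {poly F}) :
  size p = m.+2 -> (1 < size q)%N ->
  exists (v : 'I_m.+1 -> {poly F}) (D : {poly F}), D != 0 /\
    D \Po p = (\sum_i (v i \Po p) * 'X^i) * q.
Proof.
move=> sp q1; set P := p^:P - 'X%:P.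
have sP : size P = size p.
  rewrite size_polyDl ?size_polyN size_map_polyC ?sp //.
  exact: leq_ltn_trans (size_polyC_leq1 _) _.
have [||[u v] /= [_ sv] E] := @resultant_in_ideal _ P q^:P;
  rewrite ?sP ?sp ?size_map_polyC //.
exists (fun i => v`_i), (resultant P q^:P); split.
  by rewrite resultant_sub_XC_neq0 // -size_poly_gt0 (leq_trans _ q1).
(* Substituting [p(X)] for the inner variable and [X] for the outer one kills the multiple of
   [p(X) - Y] in the Bezout identity. *)
move/(congr1 (fun r => (map_poly (comp_poly p) r).['X])): E.
have compK (r : {poly F}) : (map_poly (comp_poly p) r^:P).['X] = r.
  rewrite -map_poly_comp /= (eq_map_poly (g := polyC)) => [|c] /=.
    exact: comp_polyXr.
  exact: comp_polyC.
rewrite map_polyC /= hornerC => ->.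
rewrite rmorphD !rmorphM rmorphB /= map_polyC /= !hornerE !compK comp_polyX.
rewrite subrr mulr0 add0r.
congr (_ * _); rewrite (@horner_coef_wide _ m.+1).
  by apply: eq_bigr => i _; rewrite coef_map.
apply: leq_trans (size_poly _ _) _.
by rewrite -ltnS -sp -sP.
Qed.

(** All representations [n i / d i] are covered because [ratfun_value] may pick one whose
    denominator is nonzero at a zero of the resultant. *)
Lemma inverse_rational_coefs (F : fieldType) (m : nat) (p q : {poly F}) :
  size p = m.+2 -> (1 < size q)%N ->
  exists a : 'I_m.+1 -> {fraction {poly F}},
    forall n d : 'I_m.+1 -> {poly F},
      (forall i, a i = tofrac (n i) / tofrac (d i)) ->
      (forall i, d i != 0) ->
      (\sum_i ((n i * \prod_(j | j != i) d j) \Po p) * 'X^i) * q =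
        (\prod_i d i) \Po p.
Proof.
move=> sp q1; have [v [D [D0 DE]]] := comp_inverse_relation _ _ _ _ sp q1.
exists (fun i => tofrac (v i) / tofrac D) => n d an d0.
have vd i : v i * d i = n i * D.
  apply/eqP; rewrite -tofrac_eq !tofracM -eqr_div ?tofrac_eq0 //.
  by rewrite an.
have Dp0 : D \Po p != 0 by rewrite comp_poly_eq0 ?sp.
apply: (mulfI Dp0); rewrite [in RHS]DE mulrA [RHS]mulrAC; congr (_ * _).
rewrite mulr_sumr mulr_suml; apply: eq_bigr => i _.
rewrite mulrA [RHS]mulrAC -!rmorphM /=; congr ((_ \Po _) * _).
by rewrite [in RHS](bigD1 i) //= [RHS]mulrA vd mulrCA mulrA.
Qed.

Lemma cvg_horner (K : numFieldType) (T : Type) (G : set_system T)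
    {FG : Filter G} (g : {poly K}) (f : T -> K) (a : K) :
  f x @[x --> G] --> a -> g.[f x] @[x --> G] --> g.[a].
Proof.
move=> fa; elim/poly_ind: g => [|g c IH].
  by under eq_fun do rewrite horner0; rewrite horner0; exact: cvg_cst.
under eq_fun do rewrite !hornerE; rewrite !hornerE.
by apply: cvgD; [exact: cvgM|exact: cvg_cst].
Qed.

Lemma real_is_derive_root_branch (R : realType) (p : {poly R}) (U : set R)
    (x : R -> R[i]) (q : R) (l : R[i]) :
  open U -> U q -> root_branch p U x -> real_is_derive x q l ->
  (map_poly (real_complex R) p^`()).[x q] * l = 1.
Proof.
move=> openU Uq xroot dx; set P := map_poly (real_complex R) p.
have PE t : U t -> P.[x t] = t%:C.
  move=> /xroot[_ /rootP]; rewrite rmorphB /= map_polyC /= !hornerE.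
  by move/subr0_eq.
(* The quotient [g] replaces the chain rule: at [x q] it equals the derivative of [P], and at
   [x (q + h)] its product with the difference quotient of [x] is [1] for small nonzero [h]. *)
have /factor_theorem[g gE] : root (P - P.[x q]%:P) (x q).
  by rewrite /root !hornerE subrr.
have -> : (map_poly (real_complex R) p^`()).[x q] = g.[x q].
  rewrite -deriv_map -/P -[P](subrK P.[x q]%:P) gE derivD derivC derivM.
  by rewrite derivXsubC !hornerE subrr mulr0 add0r.
have q_shift : q + h @[h --> (0 : R)^'] --> q.
  rewrite -[X in _ --> X]addr0; apply: cvgD; first exact: cvg_cst.
  exact: nbhs_dnbhs.
have shift : x (q + h) @[h --> (0 : R)^'] --> x q.
  exact: (cvg_comp _ _ q_shift (xroot q Uq).1).
have lim : g.[x (q + h)] * ((h%:C)^-1 * (x (q + h) - x q)) @[h --> (0 : R)^']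
    --> g.[x q] * l.
  exact: (cvgM (cvg_horner _ _ _ g _ _ shift) dx).
apply: (cvg_unique _ lim).
  exact: norm_hausdorff.
apply: cvg_near_cst.
near=> h.
have h0 : h%:C != 0 :> R[i].
  by rewrite (inj_eq (@complexI R)); near: h; exact: nbhs_dnbhs_neq.
rewrite mulrCA.
have -> : g.[x (q + h)] * (x (q + h) - x q) = h%:C.
  have := congr1 (horner^~ (x (q + h))) gE; rewrite !hornerE => <-.
  rewrite !PE //; first by rewrite rmorphD /= addrC addKr.
  by near: h; apply: q_shift; exact: open_nbhs_nbhs.
by rewrite mulVf.
Unshelve. all: by end_near.
Qed.

Lemma root_branch_rational_ode (R : realType) (m : nat) (p : {poly R}) (U : set R)
    (x : R -> R[i]) :
  open U -> root_branch p U x -> size p = m.+3 ->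
  @satisfies_rational_ode R m.+1 U x.
Proof.
move=> openU xroot sp.
have dp1 : (1 < size p^`())%N by rewrite size_deriv sp.
have [a aP] := inverse_rational_coefs _ _ _ _ sp dp1.
exists a => q l v Uq dx av.
have dx1 := real_is_derive_root_branch _ _ _ _ _ _ openU Uq xroot dx.
have /choice[nd ndP] : forall i, exists nd : {poly R} * {poly R},
    [/\ a i = tofrac nd.1 / tofrac nd.2, nd.2.[q] != 0
      & v i = nd.1.[q] / nd.2.[q]].
  by move=> i; have [n [d ?]] := av i; exists (n, d).
pose n i := (nd i).1; pose d i := (nd i).2.
have nd_a i : a i = tofrac (n i) / tofrac (d i) by have [] := ndP i.
have dq0 i : (d i).[q] != 0 by have [] := ndP i.
have vE i : v i = (n i).[q] / (d i).[q] by have [] := ndP i.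
have d0 i : d i != 0 by apply: contraNneq (dq0 i) => ->; rewrite horner0.
have px : (map_poly (real_complex R) p).[x q] = q%:C.
  have [_ /rootP] := xroot q Uq; rewrite rmorphB /= map_polyC /= !hornerE.
  exact: subr0_eq.
(* Since [p] sends [x q] to [q], composites with [p] take real values at [x q], namely those of [c]
   at [q]. *)
have compE (c : {poly R}) :
    (map_poly (real_complex R) (c \Po p)).[x q] = (c.[q])%:C.
  by rewrite map_comp_poly horner_comp px horner_map.
have := congr1 (fun r => (map_poly (real_complex R) r).[x q]) (aP n d nd_a d0).
rewrite rmorphM rmorph_sum /= hornerM horner_sum compE horner_prod.
set S := \sum_i _; set dq := \prod_i _ => SE.
have dqC0 : dq%:C != 0.
  by rewrite (inj_eq (@complexI R)); apply/prodf_neq0 => i _.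
(* Multiply [SE] by [l] and use [dx1], which says that [l] inverts the derivative of [p] at
   [x q]. *)
have -> : l = S / dq%:C.
  apply: (mulfI dqC0); rewrite mulrCA mulfV // mulr1.
  by rewrite -SE -mulrA dx1 mulr1.
rewrite mulr_suml; apply: eq_bigr => i _.
rewrite rmorphM /= hornerM compE rmorphXn /= map_polyX hornerXn mulrAC.
rewrite -fmorphV -rmorphM /= vE hornerM horner_prod; congr (_%:C * _).
(* The denominators with index other than [i] cancel, leaving [v i]. *)
rewrite /dq [X in _ / X](bigD1 i) //=.
rewrite -mulf_div divff ?mulr1 //.
by apply/prodf_neq0 => j _.
Qed.

Theorem corollary1p4 (R : realType) (p : {poly R}) (U : set R) (x : R -> R[i])
  (p0 : p.[0] = 0)
  (openU : open U) (U0 : U 0)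
  (xroot : root_branch p U x)
  (x0 : x q @[q --> (0 : R)^'] --> (0 : R[i])) :
  [/\ size p = 3%N -> satisfies_linear_ode U x,
      size p = 4%N -> satisfies_riccati_ode U x
    & size p = 5%N -> satisfies_abel_ode U x].
Proof.
(* Degree [m + 2] yields an ODE of degree [m + 1], here for [m = 0, 1, 2]. *)
by split=> sp; exact: root_branch_rational_ode openU xroot sp.
Qed.
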